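(* Let $(\Omega,\mathcal F)$ be a measurable space, $\mathcal P$ a nonempty set of probability measures on $(\Omega,\mathcal F)$, and put $$\mathbb E[X]=\sup_{P\in\mathcal P}E_P[X],\quad \mathcal E[X]=\inf_{P\in\mathcal P}E_P[X],\quad \mathbb V(A)=\sup_{P\in\mathcal P}P(A),\quad \nu(A)=\inf_{P\in\mathcal P}P(A).$$ Let $\{X_n\}_{n\ge1}$ be a sequence of exponential independent real random variables on $(\Omega,\mathcal F)$ (with respect to the capacity $\mathbb V$), such that $\mathbb E[X_k]=\overline\mu$ and $\mathcal E[X_k]=\underline\mu$ for all $k\ge1$, and $\sup_{k\ge1}\mathbb E[|X_k|^{1+\alpha}]<\infty$ for some $0<\alpha<1$. Then $$\lim_{n\to\infty}\nu\left(\underline\mu-\epsilon\le\frac1n\sum_{k=1}^nX_k\le\overline\mu+\epsilon\right)=1\qquad\text{for all }\epsilon>0.$$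
   Context: $E_P$ is the usual expectation under the probability measure $P$. A random variable is an $\mathcal F$-measurable map $\Omega\to\mathbb R$. A capacity is a set function $V:\mathcal F\to[0,1]$ with $V(\emptyset)=0$, $V(\Omega)=1$, and $V(A)\le V(B)$ whenever $A\subseteq B$, $A,B\in\mathcal F$; in particular $\mathbb V$ is a capacity. For a capacity $V$ and a bounded random variable $X$, the Choquet integral is $$E_V[X]=\int_0^{+\infty}V(\{X\ge t\})\,dt+\int_{-\infty}^0\big[V(\{X\ge t\})-1\big]\,dt.$$ $X_n$ is exponential independent of $X_1,\dots,X_{n-1}$ with respect to $V$ if for all bounded Borel measurable functions $\varphi_1,\dots,\varphi_n:\mathbb R\to\mathbb R$, $$E_V\big[e^{\sum_{i=1}^n\varphi_i(X_i)}\big]=E_V\big[e^{\sum_{i=1}^{n-1}\varphi_i(X_i)}\big]\cdot E_V\big[e^{\varphi_n(X_n)}\big].$$ The sequence $\{X_n\}_{n\ge1}$ is exponential independent if this holds for every $n\ge2$. In the theorem this is taken with $V=\mathbb V$. *)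

(* Defs.v *)
From HB Require Import structures.
From mathcomp Require Import all_boot all_order all_algebra.
From mathcomp Require Import all_classical all_reals all_analysis.
Set Implicit Arguments.
Unset Strict Implicit.
Unset Printing Implicit Defensive.
Import Order.TTheory GRing.Theory Num.Theory.
Import numFieldNormedType.Exports.
Local Open Scope classical_set_scope.
Local Open Scope ring_scope.
Local Open Scope ereal_scope.

(* Only the values of a set function on measurable sets are meaningful. *)
Definition is_capacity (d : measure_display) (T : measurableType d)
    (R : realType) (V : set T -> \bar R) : Prop :=
  [/\ forall A, measurable A -> 0 <= V A <= 1,
      V set0 = 0,
      V setT = 1 &
      forall A B, measurable A -> measurable B -> A `<=` B -> V A <= V B].

Definition choquet (d : measure_display) (T : measurableType d)
    (R : realType) (V : set T -> \bar R) (X : T -> R) : \bar R :=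
  \int[lebesgue_measure]_(t in `[0%R, +oo[) V [set w | (t <= X w)%R] +
  \int[lebesgue_measure]_(t in `]-oo, 0%R]) (V [set w | (t <= X w)%R] - 1).

(* X n is exponential independent of X 0, ..., X n.-1 with respect to V. *)
Definition exp_independent_of_past (d : measure_display)
    (T : measurableType d) (R : realType) (V : set T -> \bar R)
    (X : nat -> {mfun T >-> R}) (n : nat) : Prop :=
  forall phi : nat -> R -> R,
    (forall i, (i <= n)%N -> measurable_fun setT (phi i)) ->
    (forall i, (i <= n)%N -> [bounded phi i x | x in setT]) ->
    choquet V (fun w => expR (\sum_(i < n.+1) phi i (X i w))%R) =
    choquet V (fun w => expR (\sum_(i < n) phi i (X i w))%R) *
    choquet V (fun w => expR (phi n (X n w))).

(* Sequences are indexed from 0, so the first instance is X 1 against X 0. *)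
Definition exp_independent_seq (d : measure_display)
    (T : measurableType d) (R : realType) (V : set T -> \bar R)
    (X : nat -> {mfun T >-> R}) : Prop :=
  forall n, (1 <= n)%N -> exp_independent_of_past V X n.

Definition upper_expectation (d : measure_display) (T : measurableType d)
    (R : realType) (PP : set (probability T R)) (X : T -> R) : \bar R :=
  ereal_sup [set 'E_P[X] | P in PP].

Definition lower_expectation (d : measure_display) (T : measurableType d)
    (R : realType) (PP : set (probability T R)) (X : T -> R) : \bar R :=
  ereal_inf [set 'E_P[X] | P in PP].

Definition upper_probability (d : measure_display) (T : measurableType d)
    (R : realType) (PP : set (probability T R)) (A : set T) : \bar R :=
  ereal_sup [set P A | P in PP].

Definition lower_probability (d : measure_display) (T : measurableType d)
    (R : realType) (PP : set (probability T R)) (A : set T) : \bar R :=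
  ereal_inf [set P A | P in PP].

Lemma upper_probability_capacity (d : measure_display)
    (T : measurableType d) (R : realType) (PP : set (probability T R)) :
  PP !=set0 -> is_capacity (upper_probability PP).
Proof.
move=> [P0 PP0].
have cst (A : set T) (c : \bar R) : (forall P : probability T R, P A = c) ->
    upper_probability PP A = c.
  move=> PA; rewrite /upper_probability.
  suff -> : [set P A | P in PP] = [set c] by rewrite ereal_sup1.
  apply/seteqP; split=> [_ [P _ <-]|_ ->] /=; first exact: PA.
  by exists P0.
split.
- move=> A mA; apply/andP; split.
    apply: (@le_trans _ _ (P0 A)); first exact: measure_ge0.
    by apply: ereal_sup_ubound; exists P0.
  by apply: ge_ereal_sup => _ [P _ <-]; exact: probability_le1.
- by apply: cst => P; rewrite measure0.
- by apply: cst => P; rewrite probability_setT.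
- move=> A B mA mB AB; apply: ge_ereal_sup => _ [P PPP <-].
  apply: (@le_trans _ _ (P B)); first by rewrite le_measure ?inE.
  by apply: ereal_sup_ubound; exists P.
Qed.

(* Main.v *)
Require Import Defs.
From HB Require Import structures.
From mathcomp Require Import all_boot all_order all_algebra.
From mathcomp Require Import all_classical all_reals all_analysis.
From mathcomp Require Import measurable_realfun.
From mathcomp Require Import ring lra zify.
Set Implicit Arguments.
Unset Strict Implicit.
Unset Printing Implicit Defensive.
Import Order.TTheory GRing.Theory Num.Theory.
Import numFieldNormedType.Exports.
Local Open Scope classical_set_scope.
Local Open Scope ring_scope.
Local Open Scope ereal_scope.

(* Exponential independence with exponents [lam * k (X i)], [k] a bounded
   [nat]-valued quantization, says that for every [x > 1] the generating function
   of the law with tail [j |-> V(s > j)], where [s = k (X 0) + ... + k (X n.-1)],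
   is the product of those of the laws with tails [V(k (X i) > j)].  Hence, under
   [V], Chernoff's bound controls the upper deviations of [s] from the sum [M] of
   the Choquet means of the [k (X i)], and the Choquet mean of [s] is at least [M].  Choquet means
   may exceed upper expectations, so [M] still has to be bounded by [n * mt],
   where [mt] bounds the upper expectations: as the Choquet mean is not below [M]
   and the tail vanishes just above [M], the tail is almost [1] up to nearly [M],
   so some [P] in [PP] gives [s] an expectation close to [M], while it is at most
   [n * mt].  The truncation and quantization error is controlled by Markov's
   inequality under each [P] separately, and the lower bound is the upper bound
   for [- X]. *)

(** * Generating functions of tails and deterministic tail bounds *)

Section TailGeneratingFunction.
Context {R : realType}.
Local Open Scope ring_scope.

(* If [G j = Q(s > j)] for a law [Q] on [{0, ..., N}], this is the [Q]-mean of
   [x ^+ s], after summation by parts. *)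
Definition tail_gf (N : nat) (G : nat -> R) (x : R) : R :=
  1 + \sum_(j < N) (x ^+ j.+1 - x ^+ j) * G j.

Lemma tail_gf_ge N (G : nat -> R) x : 1 <= x -> (forall j, 0 <= G j) ->
  1 + (x - 1) * (\sum_(j < N) G j) <= tail_gf N G x.
Proof.
move=> x1 G0; rewrite lerD2l mulr_sumr; apply: ler_sum => j _.
rewrite ler_wpM2r// exprS -[leRHS]/(x * x ^+ j - x ^+ j) -{2}[x ^+ j]mul1r -mulrBl.
by rewrite ler_peMr ?subr_ge0// exprn_ege1.
Qed.

Lemma tail_gf_le N (G : nat -> R) x : 1 <= x -> (forall j, 0 <= G j) ->
  tail_gf N G x <= 1 + (x - 1) * x ^+ N * (\sum_(j < N) G j).
Proof.
move=> x1 G0; rewrite lerD2l mulr_sumr; apply: ler_sum => j _.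
rewrite ler_wpM2r// exprS -{2}[x ^+ j]mul1r -mulrBl.
by rewrite ler_wpM2l ?subr_ge0// ler_weXn2l// ltnW.
Qed.

(** Only the increments up to [t] are kept, where [G] is at least [G t]; they telescope to
    [x ^+ t.+1 - 1], and the leading [1] makes up for the missing [G t <= 1]. *)
Lemma tail_gf_markov N (G : nat -> R) x t : 1 <= x -> (forall j, 0 <= G j <= 1) ->
  {homo G : i j / (i <= j)%N >-> j <= i} -> (t < N)%N ->
  x ^+ t.+1 * G t <= tail_gf N G x.
Proof.
move=> x1 G01 Gmono tN.
have inc j : 0 <= x ^+ j.+1 - x ^+ j by rewrite subr_ge0 ler_weXn2l.
apply: (@le_trans _ _ (1 + \sum_(j < t.+1) (x ^+ j.+1 - x ^+ j) * G t)).
  rewrite -mulr_suml -(big_mkord xpredT (fun j => x ^+ j.+1 - x ^+ j)).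
  rewrite telescope_sumr// expr0 mulrBl mul1r.
  by have /andP[_] := G01 t; lra.
rewrite lerD2l -(subnKC tN) big_split_ord/= -[leLHS]addr0 lerD//.
  by apply: ler_sum => j _; rewrite ler_wpM2l ?inc// Gmono// -ltnS.
by apply: sumr_ge0 => j _; rewrite mulr_ge0 ?inc//; case/andP: (G01 (t.+1 + j)%N).
Qed.

Lemma bernoulli_ineq (y : R) n : y <= 1 -> 1 - n%:R * y <= (1 - y) ^+ n.
Proof.
move=> y1; elim: n => [|n IH]; first by rewrite mul0r subr0 expr0.
rewrite exprS.
apply: (@le_trans _ _ ((1 - y) * (1 - n%:R * y))); last by rewrite ler_wpM2l ?subr_ge0.
have : 0 <= n%:R * y ^+ 2 by rewrite mulr_ge0// sqr_ge0.
rewrite -natr1; nra.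
Qed.

Lemma prod1D_ge n (a : nat -> R) : (forall i, 0 <= a i) ->
  1 + \sum_(i < n) a i <= \prod_(i < n) (1 + a i).
Proof.
move=> a0; elim: n => [|n IH]; first by rewrite !big_ord0 addr0.
rewrite !big_ord_recr/=.
have s0 : 0 <= \sum_(i < n) a i by apply: sumr_ge0.
have := a0 n; nra.
Qed.

(* Compare the two sides to first order at [x = 1]. *)
Lemma tail_mean_superadditive N K n (G : nat -> R) (p : nat -> nat -> R) :
    (forall j, 0 <= G j) -> (forall i j, 0 <= p i j) ->
    (forall x, 1 < x -> tail_gf N G x = \prod_(i < n) tail_gf K (p i) x) ->
  \sum_(i < n) \sum_(j < K) p i j <= \sum_(j < N) G j.
Proof.
move=> G0 p0 H; set M := \sum_(i < n) _; set S := \sum_(j < N) _.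
have M0 : 0 <= M by apply: sumr_ge0 => i _; apply: sumr_ge0.
have MS x : 1 < x -> M <= x ^+ N * S.
  move=> x1; have x1' := ltW x1.
  have : 1 + (x - 1) * M <= 1 + (x - 1) * (x ^+ N * S).
    rewrite [in leRHS]mulrA.
    apply: le_trans _ (@tail_gf_le N G x x1' G0); rewrite H//.
    rewrite mulr_sumr.
    apply: le_trans (@prod1D_ge n (fun i => (x - 1) * \sum_(j < K) p i j) _) _.
      by move=> i; rewrite mulr_ge0 ?subr_ge0//; apply: sumr_ge0.
    apply: ler_prod => i _; rewrite tail_gf_ge// andbT addr_ge0// mulr_ge0 ?subr_ge0//.
    exact: sumr_ge0.
  by rewrite lerD2l ler_pM2l// subr_gt0.
(* Take [x = (1 - y)^-1]; Bernoulli's inequality bounds [x ^- N] below by a linear function of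
   [y]. *)
have MS' y : 0 < y -> y < 1 -> M * (1 - N%:R * y) <= S.
  move=> y0 y1; have y1' : 0 < 1 - y by rewrite subr_gt0.
  apply: (@le_trans _ _ (M * (1 - y) ^+ N)).
    by rewrite ler_wpM2l// bernoulli_ineq// ltW.
  rewrite -ler_pdivlMr ?exprn_gt0// mulrC -exprVn; apply: MS.
  by rewrite invf_gt1// gtrBl.
apply/ler_addgt0Pr => e e0.
have MN0 : 0 <= M * N%:R by rewrite mulr_ge0.
pose y := e / (e + M * N%:R + 1).
have d0 : 0 < e + M * N%:R + 1 by lra.
have := MS' y; rewrite divr_gt0// ltr_pdivrMr// mul1r => /(_ erefl) H1.
have {}H1 : M * (1 - N%:R * y) <= S by apply: H1; lra.
suff : M * N%:R * y <= e by move: H1; rewrite mulrBr mulr1 mulrA; lra.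
by rewrite mulrA ler_pdivrMr// mulrC ler_pM2l//; lra.
Qed.

(** Each factor, with tail sum [m], is at most [1 + (x - 1) * x ^+ K * m], hence at most the
    exponential of [(x - 1) * x ^+ K * m]; then [x - 1 <= lam * x] for [x = expR lam]. *)
Lemma tail_chernoff N K n (G : nat -> R) (p : nat -> nat -> R) (lam : R) t :
    0 <= lam ->
    (forall j, 0 <= G j <= 1) -> {homo G : i j / (i <= j)%N >-> j <= i} ->
    (forall j, (N <= j)%N -> G j = 0) -> (forall i j, 0 <= p i j) ->
    tail_gf N G (expR lam) = \prod_(i < n) tail_gf K (p i) (expR lam) ->
  G t <= expR (lam * (expR (lam * K.+1%:R) * (\sum_(i < n) \sum_(j < K) p i j)
                      - t.+1%:R)).
Proof.
move=> lam0 G01 Gmono GN p0 H.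
have [Nt|tN] := leqP N t; first by rewrite GN// expR_ge0.
have x1 : 1 <= expR lam by rewrite -expR0 ler_expR.
rewrite mulrBr expRD expRN -ler_pdivrMr ?invr_gt0 ?expR_gt0// invrK mulrC.
rewrite (expRM_natr t.+1 lam).
apply: le_trans (@tail_gf_markov N G (expR lam) t x1 G01 Gmono tN) _.
rewrite H mulr_sumr mulr_sumr expR_sum; apply: ler_prod => i _.
have m0 : 0 <= \sum_(j < K) p i j by apply: sumr_ge0.
apply/andP; split.
  apply: le_trans _ (@tail_gf_ge K (p i) _ x1 (p0 i)).
  by rewrite addr_ge0// mulr_ge0// subr_ge0.
apply: le_trans (@tail_gf_le K (p i) _ x1 (p0 i)) _.
apply: le_trans (expR_ge1Dx _) _; rewrite ler_expR.
rewrite mulrA ler_wpM2r// -natr1 mulrDr mulr1 expRD expRM_natr.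
rewrite [leRHS]mulrCA mulrC ler_wpM2l ?exprn_ge0 ?expR_ge0//.
have : 1 - lam <= (expR lam)^-1 by rewrite -expRN expR_ge1Dx.
by rewrite -[leRHS]mul1r ler_pdivlMr ?expR_gt0//; lra.
Qed.

(** Chernoff's bound inflates the mean by [expR (lam * K.+1%:R)]; this [lam] keeps the excess within
    [e] per variable with values up to [K]. It comes from [expR u <= (1 - u)^-1]. *)
Lemma expR_sub1_small (K : nat) (e : R) : 0 < e ->
  exists2 lam : R, 0 < lam & (expR (lam * K.+1%:R) - 1) * K%:R <= e.
Proof.
move=> e0.
have k0 : 0 < K.+1%:R :> R by rewrite ltr0n.
pose u : R := e / (e + K.+1%:R).
have d0 : 0 < e + K.+1%:R by rewrite addr_gt0.
have u0 : 0 < u by rewrite divr_gt0.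
have u1 : 1 - u = K.+1%:R / (e + K.+1%:R).
  by rewrite /u -[X in X - _](@divff _ (e + K.+1%:R)) ?gt_eqF// -mulrBl addrAC subrr add0r.
exists (u / K.+1%:R); first by rewrite divr_gt0.
rewrite divfK ?gt_eqF//.
have : expR u <= (1 - u)^-1.
  rewrite -[expR u]invrK lef_pV2 ?posrE ?invr_gt0 ?expR_gt0// ?u1 ?divr_gt0//.
  by rewrite -u1 -expRN expR_ge1Dx.
rewrite u1 invf_div => H.
have {}H : expR u - 1 <= e / K.+1%:R.
  by rewrite lerBlDr (le_trans H)// mulrDl divff ?gt_eqF.
apply: (@le_trans _ _ (e / K.+1%:R * K%:R)); first by rewrite ler_wpM2r.
by rewrite mulrAC ler_pdivrMr// ler_pM2l// ler_nat.
Qed.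

(** [G j] is at most [1] before [a], at most [G a] from [a] on and at most [del] from [b] on; the
    dominating summand covers both orders of [a] and [b]. *)
Lemma sum_tail_le N (G : nat -> R) (a b : nat) (del : R) :
    (forall j, 0 <= G j <= 1) -> {homo G : i j / (i <= j)%N >-> j <= i} ->
    0 <= del -> (forall j, (b <= j)%N -> G j <= del) ->
  \sum_(j < N) G j <= (1 - G a) * a%:R + G a * b%:R + N%:R * del.
Proof.
move=> G01 Gmono del0 Gb.
have cnt (c : nat) : \sum_(j < N) ((j < c)%N%:R : R) <= c%:R.
  rewrite -natr_sum ler_nat.
  suff -> : (\sum_(j < N) (j < c : nat) = minn N c)%N by rewrite geq_minr.
  by elim: N => [|m IHm]; [rewrite big_ord0 min0n | rewrite big_ord_recr/= IHm; lia].
have /andP[q0 q1] := G01 a.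
apply: (@le_trans _ _ (\sum_(j < N) ((1 - G a) * (j < a)%N%:R + G a * (j < b)%N%:R + del))).
  apply: ler_sum => j _.
  have /andP[g0 g1] := G01 j.
  have [ja|/Gmono aj] := ltnP j a; have [jb|/Gb bj] := ltnP j b; rewrite ?mulr1 ?mulr0; lra.
rewrite !big_split/= -!mulr_sumr sumr_const card_ord -[del *+ N]mulr_natl.
by rewrite lerD2r lerD// ler_wpM2l ?subr_ge0.
Qed.

(* The bound on [j.+1%:R * G j] is Markov's inequality for the upper expectations,
   which are at most [mt]; the Choquet means [\sum_j p i j] are not assumed to
   be.  With [a] near [n * (mt + eta)] and [b] near [M], the lower bound [M] on
   [\sum_j G j] and [sum_tail_le] give [(1 - G a) * M <= (1 - G a) * a + o(n)],
   where Markov's inequality keeps [1 - G a] away from [0]. *)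
Lemma tail_small K (mt eta e : R) : 0 <= mt -> 0 < eta -> 0 < e ->
  exists n0 : nat, forall n (G : nat -> R) (p : nat -> nat -> R), (n0 <= n)%N ->
    (forall j, 0 <= G j <= 1) -> {homo G : i j / (i <= j)%N >-> j <= i} ->
    (forall j, (n * K <= j)%N -> G j = 0) ->
    (forall i j, 0 <= p i j <= 1) ->
    (forall x, 1 < x -> tail_gf (n * K) G x = \prod_(i < n) tail_gf K (p i) x) ->
    (forall j, j.+1%:R * G j <= n%:R * mt) ->
  forall t, n%:R * (mt + 4 * eta) <= t.+1%:R -> G t <= e.
Proof.
move=> mt0 eta0 e0.
(* Markov's inequality at level [n%:R * (mt + eta)] will give [q <= mt / (mt + eta)], that is
   [1 - q >= D^-1]. *)
pose D := (mt + eta) / eta.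
have me0 : 0 < mt + eta by rewrite ltr_wpDl.
have D0 : 0 < D by rewrite divr_gt0.
have Deta : D * eta = mt + eta by rewrite divfK ?gt_eqF.
have D1 : 1 <= D by rewrite ler_pdivlMr// mul1r lerDr.
clearbody D.
(* The errors [ep] and [e1] are scaled so that [D * ep] and [K%:R * (D * e1)] stay within [eta]. *)
pose ep := eta / D.
have ep0 : 0 < ep by rewrite divr_gt0.
have Dep : D * ep = eta by rewrite mulrC divfK ?gt_eqF.
have epeta : ep <= eta by rewrite ler_pdivrMr// ler_peMr// ltW.
pose e1 := Num.min e (eta / (K.+1%:R * D)).
have k0 : 0 < K.+1%:R :> R by rewrite ltr0n.
have e10 : 0 < e1 by rewrite lt_min e0 divr_gt0// mulr_gt0.
have [|lam lam0 Hlam] := @expR_sub1_small K (ep / 2); first by rewrite divr_gt0.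
pose a := lam * (ep / 2).
have a0 : 0 < a by rewrite mulr_gt0// divr_gt0.
(* From here on, [expR (- (a * n%:R)) <= (1 + a * n%:R)^-1 <= e1]. *)
exists (Num.truncn (a * e1)^-1).+1 => n G p n0n G01 Gmono GN p01 H markov.
have p0 i j : 0 <= p i j by case/andP: (p01 i j).
have G0 j : 0 <= G j by case/andP: (G01 j).
set M := \sum_(i < n) \sum_(j < K) p i j.
have ngt0 : 0 < n%:R :> R by rewrite ltr0n (leq_trans _ n0n).
have M0 : 0 <= M by apply: sumr_ge0 => i _; apply: sumr_ge0.
have MnK : M <= n%:R * K%:R.
  have : M <= \sum_(i < n) \sum_(j < K) 1.
    by apply: ler_sum => i _; apply: ler_sum => j _; case/andP: (p01 i j).
  by rewrite !sumr_const !card_ord -[_ *+ n]mulr_natl.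
(* Half of the margin [n%:R * ep] pays for the inflated mean, since [M <= n%:R * K%:R]; the other
   half yields the decay in [n]. *)
have small t : M + n%:R * ep <= t.+1%:R -> G t <= e1.
  move=> Ht; have x1 : 1 < expR lam by rewrite expR_gt1.
  apply: le_trans (@tail_chernoff (n * K) K n G p lam t (ltW lam0) G01 Gmono GN p0 (H _ x1)) _.
  apply: (@le_trans _ _ (expR (- (a * n%:R)))).
    rewrite ler_expR /a -mulrA -mulrN ler_pM2l//.
    have : (expR (lam * K.+1%:R) - 1) * M <= n%:R * (ep / 2).
      apply: (@le_trans _ _ ((expR (lam * K.+1%:R) - 1) * (n%:R * K%:R))).
        rewrite ler_wpM2l// subr_ge0 -expR0 ler_expR mulr_ge0//.
        exact: ltW.
      by rewrite mulrCA ler_pM2l.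
    rewrite mulrBl mul1r -/M; lra.
  rewrite expRN -[e1]invrK lef_pV2 ?posrE ?invr_gt0 ?expR_gt0//.
  apply: le_trans (expR_ge1Dx _).
  have : (a * e1)^-1 <= n%:R.
    by apply/ltW/(lt_le_trans (truncnS_gt _)); rewrite ler_nat.
  rewrite invfM mulrC ler_pdivrMr// [a * _]mulrC; lra.
have ME : M <= n%:R * (mt + 3 * eta).
  pose i1 := Num.truncn (n%:R * (mt + eta)); pose i2 := Num.truncn (M + n%:R * ep).
  have y10 : 0 <= n%:R * (mt + eta) by rewrite mulr_ge0// ltW.
  have y20 : 0 <= M + n%:R * ep by rewrite addr_ge0// mulr_ge0// ltW.
  have i1le : i1%:R <= n%:R * (mt + eta) by rewrite truncn_le.
  have i2le : i2%:R <= M + n%:R * ep by rewrite truncn_le.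
  have i1gt : n%:R * (mt + eta) < i1.+1%:R by exact: truncnS_gt.
  have SS := @sum_tail_le (n * K) G i1 i2 e1 G01 Gmono (ltW e10).
  have smalli2 j : (i2 <= j)%N -> G j <= e1.
    move=> i2j; apply: small; apply/ltW/(lt_le_trans (truncnS_gt _)).
    by rewrite ler_nat ltnS.
  have {}SS := SS smalli2.
  have := @tail_mean_superadditive (n * K) K n G p G0 p0 H; rewrite -/M.
  move: SS; set S := \sum_(j < n * K) G j; set q := G i1 => SS MS.
  have /andP[q0 q1] := G01 i1; rewrite -/q in q0 q1.
  have qD : 1 <= D * (1 - q).
    have : n%:R * (mt + eta) * q <= n%:R * mt.
      by apply: le_trans (markov i1); rewrite ler_wpM2r// ltW.
    rewrite -mulrA ler_pM2l// => h; rewrite -(ler_pM2r eta0) mul1r mulrAC Deta; lra.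
  have e1K : K%:R * (D * e1) <= eta.
    have : e1 <= eta / (K.+1%:R * D) by rewrite /e1 ge_min lexx orbT.
    rewrite ler_pdivlMr ?mulr_gt0// -natr1 => h.
    have := mulr_gt0 D0 e10; lra.
  (* Chaining [M <= S] with the bound on [S] leaves [q * M] on the right; cancelling it gives a
     bound on [(1 - q)] times the excess of [M]. A positive excess can then be freed of [1 - q] by
     multiplying by [D]. *)
  have B1 : (1 - q) * M <= (1 - q) * (n%:R * (mt + eta)) + n%:R * ep + n%:R * K%:R * e1.
    have h1 : (1 - q) * i1%:R <= (1 - q) * (n%:R * (mt + eta)).
      by rewrite ler_wpM2l// subr_ge0.
    have h2 : q * i2%:R <= q * (M + n%:R * ep) by rewrite ler_wpM2l.
    have h3 : q * (n%:R * ep) <= n%:R * ep.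
      by rewrite ler_piMl// mulr_ge0// ltW.
    rewrite natrM in SS; lra.
  have [//|/ltW Mbig] := leP M (n%:R * (mt + eta)); first by nra.
  have B2 : M - n%:R * (mt + eta) <= D * (1 - q) * (M - n%:R * (mt + eta)).
    by rewrite ler_peMl// subr_ge0.
  have B3 : D * ((1 - q) * (M - n%:R * (mt + eta))) <= D * (n%:R * ep + n%:R * K%:R * e1).
    rewrite ler_pM2l//; lra.
  have B4 : D * (n%:R * ep + n%:R * K%:R * e1) <= n%:R * (2 * eta).
    rewrite (_ : _ * _ = n%:R * (D * ep + K%:R * (D * e1))); last by ring.
    by rewrite ler_pM2l// Dep; lra.
  by rewrite mulrA in B3; lra.
move=> t Ht; apply: (@le_trans _ _ e1); last by rewrite /e1 ge_min lexx.
apply: small; apply: le_trans Ht.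
have : n%:R * ep <= n%:R * eta by rewrite ler_pM2l.
lra.
Qed.

End TailGeneratingFunction.

(** * Choquet integrals of step functions *)

(** For [t] in []f j, f j.+1]] the superlevel set of [f (s w)] is that of [s] at [j.+1], so the
    first integrand is a step function. For [t <= 0] the set has capacity [u 0 = 1], and the second
    integral vanishes. *)
Lemma choquet_step (d : measure_display) (T : measurableType d) (R : realType)
    (V : set T -> \bar R) (s : T -> nat) (N : nat) (f u : nat -> R) :
    V set0 = 0 -> u 0%N = 1%R -> (forall j, 0 <= u j)%R ->
    (forall j, V [set w | (j <= s w)%N] = (u j)%:E) -> (forall w, s w <= N)%N ->
    (0 <= f 0%N)%R -> {homo f : i j / (i <= j)%N >-> (i <= j)%R} ->
  choquet V (fun w => f (s w)) =
    (f 0%N + \sum_(j < N) (f j.+1 - f j) * u j.+1)%:E.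
Proof.
move=> V0 u0 uge0 Vu sN f0 fmono.
have Vtail (t : R) j : (t <= f j)%R -> (forall i, (i < j)%N -> (f i < t)%R) ->
    V [set w | (t <= f (s w))%R] = (u j)%:E.
  move=> tj jt; rewrite -Vu; congr V; apply/seteqP; split=> w /= h.
    by rewrite leqNgt; apply/negP => /jt; rewrite ltNge h.
  by rewrite (le_trans tj)// fmono.
rewrite /choquet [X in _ + X](_ : _ = 0) ?adde0; last first.
  apply: integral0_eq => t; rewrite /= in_itv/= => t0.
  by rewrite (Vtail _ 0%N) ?u0 ?subee// (le_trans t0).
pose I j : set R := if j is i.+1 then `]f i, f i.+1]%classic else `[0%R, f 0%N]%classic.
have mI j : measurable (I j) by case: j => [|j]; exact: measurable_itv.
transitivity (\int[lebesgue_measure]_(t in `[0%R, +oo[)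
    \sum_(j < N.+1) ((u j)%:E * (\1_(I j) t)%:E)).
  apply: eq_integral => t; rewrite inE/= in_itv/= andbT => t0.
  have IN i j : (f i < t)%R -> (j <= i)%N -> (\1_(I j) t)%:E = 0%E :> \bar R.
    move=> it ji; rewrite indicE memNset//; case: j ji => [|j] ji /=;
      rewrite in_itv/= => /andP[_ tj];
      by have := lt_le_trans it (le_trans tj (fmono _ _ ji)); rewrite ltxx.
  (* [f] may be bounded, so [t] can exceed all its values; both sides are then zero. *)
  have [[j tj]|nt] := pselect (exists j, (t <= f j)%R); last first.
    have ft j : (f j < t)%R by rewrite ltNge; apply/negP => h; apply: nt; exists j.
    rewrite [X in V X](_ : _ = set0) ?V0.
      by rewrite big1// => j _; rewrite (IN _ _ (ft j)) ?mule0.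
    by rewrite -subset0 => w /=; rewrite leNgt ft.
  have ex : exists j, (t <= f j)%R by exists j.
  case: (ex_minnP ex) => k tk kmin {j tj ex}.
  have ltk i : (i < k)%N -> (f i < t)%R.
    by move=> ik; rewrite ltNge; apply/negP => /kmin; rewrite leqNgt ik.
  rewrite (Vtail _ k)//.
  have Ik : t \in I k.
    rewrite inE; case: k tk ltk {kmin} => [|k] tk ltk /=; rewrite in_itv/= tk ?t0//.
    by rewrite ltk.
  have Ink j : j != k -> (\1_(I j) t)%:E = 0%E :> \bar R.
    rewrite neq_ltn => /orP[jk|kj]; first exact: IN (ltk _ jk) _.
    rewrite indicE memNset//; case: j kj => [//|j] kj /=; rewrite in_itv/= => /andP[jt _].
    by have := lt_le_trans jt (le_trans tk (fmono k j kj)); rewrite ltxx.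
  (* Above [f N] no cell of the sum contains [t], in agreement with [u k = V set0 = 0]. *)
  have [kN|Nk] := leqP k N.
    rewrite (bigD1 (Ordinal (kN : k < N.+1)%N))//= indicE Ik mule1.
    by rewrite big1 ?adde0// => i ik; rewrite Ink ?mule0.
  rewrite big1 => [|i _]; last by rewrite Ink ?mule0// neq_ltn (leq_trans (ltn_ord i)).
  have := Vu k; rewrite [X in V X](_ : _ = set0) ?V0//.
  by rewrite -subset0 => w /=; rewrite leqNgt (leq_ltn_trans (sN w)).
rewrite ge0_integral_sum//; first last.
- by move=> j t _; rewrite mule_ge0// lee_fin.
- by move=> j; apply/measurable_funeM/measurable_EFinP/measurable_indic; exact: mI.
have Isub j : I j `&` `[0%R, +oo[ = I j.
  apply/setIidPl => t; case: j => [|j] /=; rewrite !in_itv/= => /andP[jt _]; rewrite andbT//.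
  by rewrite (le_trans _ (ltW jt))// (le_trans f0)// fmono.
rewrite (eq_bigr (fun j : 'I_N.+1 =>
    (u j)%:E * lebesgue_measure (I j))); last first.
  move=> j _; rewrite ge0_integralZl//; last by rewrite lee_fin.
    by rewrite integral_indic ?Isub//; exact: mI.
  by apply/measurable_EFinP/measurable_indic; exact: mI.
rewrite big_ord_recl/= u0 mul1e lebesgue_measure_itv/= lte_fin EFinD -sumEFin.
congr (_ + _).
  case: ltP => h; first by rewrite oppr0 adde0.
  by congr (_%:E); apply/eqP; rewrite eq_le f0 h.
apply: eq_bigr => j _; rewrite lebesgue_measure_itv/= lte_fin -EFinD.
rewrite mulrC EFinM; congr (_ * _).
case: ltP => // h; congr (_%:E); apply/eqP; rewrite eq_sym subr_eq0 eq_le h/=.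
exact: fmono.
Qed.

(** * Measurability and Markov's inequality for sums *)

Lemma measurable_superlevel (d : measure_display) (T : measurableType d)
    (R : realType) (f : T -> R) (a : R) :
  measurable_fun setT f -> measurable [set w | (a <= f w)%R].
Proof.
move=> mf; rewrite [X in measurable X](_ : _ = setT `&` f @^-1` `[a, +oo[%classic).
  by apply: mf => //; exact: measurable_itv.
by rewrite setTI; apply/seteqP; split=> w /=; rewrite in_itv/= andbT.
Qed.

Lemma measurable_norm_powR (d : measure_display) (T : measurableType d)
    (R : realType) (f : T -> R) (a : R) :
  measurable_fun setT f -> measurable_fun setT (fun w => `|f w| `^ a)%R.
Proof.
move=> mf; apply: (@measurableT_comp _ _ _ _ _ _ (@powR R ^~ a)%R).
  exact: measurable_powR.
by apply: measurableT_comp => //; exact: normr_measurable.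
Qed.

Lemma measurable_natr_ge (d : measure_display) (T : measurableType d)
    (R : realType) (s : T -> nat) (j : nat) :
  measurable_fun setT (fun w => (s w)%:R : R) -> measurable [set w | (j <= s w)%N].
Proof.
move=> ms; rewrite [X in measurable X](_ : _ = [set w | (j%:R <= (s w)%:R :> R)%R]).
  exact: measurable_superlevel.
by apply/seteqP; split=> w /=; rewrite ler_nat.
Qed.

Lemma measurable_natr_sum (d : measure_display) (T : measurableType d)
    (R : realType) (s : nat -> T -> nat) (n : nat) :
  (forall i, measurable_fun setT (fun w => (s i w)%:R : R)) ->
  measurable_fun setT (fun w => (\sum_(i < n) s i w)%N%:R : R).
Proof.
move=> ms; under eq_fun do rewrite natr_sum.
exact: measurable_sum.
Qed.

Lemma markov_sum (d : measure_display) (T : measurableType d) (R : realType)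
    (P : probability T R) (f : nat -> T -> R) (n : nat) (r a : R) :
    (forall i, measurable_fun setT (f i)) -> (forall i w, 0 <= f i w)%R ->
    (forall i, \int[P]_w (f i w)%:E <= r%:E) -> (0 <= a)%R ->
  a%:E * P [set w | (a <= \sum_(i < n) f i w)%R] <= (n%:R * r)%:E.
Proof.
move=> mf f0 fr a0.
have mS : measurable [set w | (a <= \sum_(i < n) f i w)%R].
  by apply: measurable_superlevel; exact: measurable_sum.
rewrite -[X in P X]setIT -integral_indic// -ge0_integralZl//; last first.
  by apply/measurable_EFinP/measurable_indic.
apply: (@le_trans _ _ (\int[P]_w (\sum_(i < n) (f i w)%:E))).
  apply: ge0_le_integral => //.
  - by move=> w _; rewrite mule_ge0// lee_fin.

  - by apply/measurable_funeM/measurable_EFinP/measurable_indic.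
  - by apply: emeasurable_sum => i; apply/measurable_EFinP/mf.
  - move=> w _; rewrite sumEFin -EFinM lee_fin indicE.
    case: (boolP (w \in _)) => [|_]; last by rewrite mulr0 sumr_ge0.
    by rewrite inE mulr1.
rewrite ge0_integral_sum//; [|by move=> i; apply/measurable_EFinP/mf|].
  apply: (@le_trans _ _ (\sum_(i < n) r%:E)); first by apply: lee_sum => i _; exact: fr.
  by rewrite sumEFin sumr_const card_ord -[(r *+ n)%R]mulr_natl.
by move=> i w _; rewrite lee_fin.
Qed.

(** * Weak law for sums of bounded quantizations *)

Section UpperProbability.
Context {d : measure_display} {T : measurableType d} {R : realType}.
Variable PP : set (probability T R).
Hypothesis PP0 : PP !=set0.

Definition fine_upper (A : set T) : R := fine (upper_probability PP A).

Lemma fine_upperE A : measurable A ->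
  upper_probability PP A = (fine_upper A)%:E.
Proof.
move=> mA; have [V01 _ _ _] := upper_probability_capacity PP0.
have /andP[V0 V1] := V01 _ mA.
by rewrite /fine_upper fineK// fin_numElt (lt_le_trans _ V0)// (le_lt_trans V1)// ltry.
Qed.

Lemma fine_upper_bounds A : measurable A -> (0 <= fine_upper A <= 1)%R.
Proof.
move=> mA; have [V01 _ _ _] := upper_probability_capacity PP0.
by have := V01 _ mA; rewrite fine_upperE// !lee_fin.
Qed.

Lemma le_fine_upper A B : measurable A -> measurable B -> A `<=` B ->
  (fine_upper A <= fine_upper B)%R.
Proof.
move=> mA mB AB; have [_ _ _ Vle] := upper_probability_capacity PP0.
by have := Vle _ _ mA mB AB; rewrite !fine_upperE// lee_fin.
Qed.

Lemma fine_upper0 : fine_upper set0 = 0%R.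
Proof. by have [_ V0 _ _] := upper_probability_capacity PP0; rewrite /fine_upper V0. Qed.

(** The step values are the powers of [expR lam]; the jump from [j] to [j.+1] is weighted by the
    event [j.+1 <= s w], hence the strict tail. *)
Lemma choquet_expR_natr (s : T -> nat) (N : nat) (lam : R) : (0 <= lam)%R ->
    measurable_fun setT (fun w => (s w)%:R : R) -> (forall w, s w <= N)%N ->
  choquet (upper_probability PP) (fun w => expR (lam * (s w)%:R)) =
    (tail_gf N (fun j => fine_upper [set w | (j < s w)%N]) (expR lam))%:E.
Proof.
move=> lam0 ms sN; have mj j := measurable_natr_ge j ms.
have [_ V0 V1 _] := upper_probability_capacity PP0.
rewrite (@choquet_step _ _ _ _ s N (fun j => expR (lam * j%:R))
  (fun j => fine_upper [set w | (j <= s w)%N]))//.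
- rewrite mulr0 expR0; congr (_%:E); congr (_ + _)%R.
  by apply: eq_bigr => j _; rewrite !expRM_natr.
- by rewrite /fine_upper [X in upper_probability _ X](_ : _ = setT) ?V1//; apply/seteqP.
- by move=> j; case/andP: (fine_upper_bounds (mj j)).
- by move=> j; rewrite fine_upperE.
- by move=> i j ij; rewrite ler_expR ler_wpM2l// ler_nat.
Qed.

Variables (X : nat -> {mfun T >-> R}) (k : R -> nat) (K : nat).
Hypothesis indep : exp_independent_seq (upper_probability PP) X.
Hypothesis mk : measurable_fun setT (fun x => (k x)%:R : R).
Hypothesis kK : forall x, (k x <= K)%N.

Lemma measurable_natr_comp i : measurable_fun setT (fun w => (k (X i w))%:R : R).
Proof. by apply: (measurableT_comp mk); exact: measurable_funPT. Qed.

Lemma sum_nat_le_mul n w : (\sum_(i < n) k (X i w) <= n * K)%N.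
Proof.
rewrite -[X in (_ <= X * _)%N]card_ord -sum_nat_const.
by apply: leq_sum => i _; exact: kK.
Qed.

(** With [lam = ln x], the test functions [lam * k] are bounded because [k] is, so exponential
    independence splits off one factor at each induction step. *)
Lemma tail_gf_sum_indep n (x : R) : (1 < x)%R ->
  (tail_gf (n * K) (fun j => fine_upper [set w | (j < \sum_(i < n) k (X i w))%N]) x =
   \prod_(i < n) tail_gf K (fun j => fine_upper [set w | (j < k (X i w))%N]) x)%R.
Proof.
move=> x1; have x0 : (0 < x)%R by rewrite (lt_trans _ x1).
pose lam := ln x.
have lam0 : (0 <= lam)%R by rewrite ln_ge0// ltW.
have -> : x = expR lam by rewrite lnK.
(* Independence needs a nonempty past, so [n = 0] and [n = 1] are both base cases. *)
elim: n => [|[_|n IH]]; first by rewrite mul0n big_ord0 /tail_gf big_ord0 addr0.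
  rewrite big_ord1 mul1n; congr tail_gf; apply/funext => j.
  by congr fine_upper; apply/seteqP; split=> w /=; rewrite big_ord1.
rewrite big_ord_recr/= -IH; apply: EFin_inj; rewrite EFinM.
have chE m := @choquet_expR_natr _ _ lam lam0
  (measurable_natr_sum m measurable_natr_comp) (sum_nat_le_mul m).
rewrite -!chE -(choquet_expR_natr lam0 (measurable_natr_comp _))//.
have sumE m w : (lam * (\sum_(i < m) k (X i w))%N%:R =
    \sum_(i < m) lam * (k (X i w))%:R)%R by rewrite natr_sum mulr_sumr.
under eq_fun do rewrite sumE.
under [in RHS]eq_fun do rewrite sumE.
apply: (indep (n := n.+1) isT (phi := fun _ x => (lam * (k x)%:R)%R)) => i _.
  exact: measurable_funM.
exists (lam * K%:R)%R; split; first exact: num_real.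
move=> M lM y _ /=; rewrite ger0_norm ?mulr_ge0//.
by rewrite (le_trans _ (ltW lM))// ler_wpM2l// ler_nat.
Qed.

Variable mt : R.
Hypothesis Ek : forall i P, PP P -> \int[P]_w ((k (X i w))%:R)%:E <= mt%:E.

Lemma markov_sum_upper n j :
  (j.+1%:R * fine_upper [set w | (j < \sum_(i < n) k (X i w))%N] <= n%:R * mt)%R.
Proof.
have mA := measurable_natr_ge j.+1 (measurable_natr_sum n measurable_natr_comp).
rewrite mulrC -ler_pdivlMr ?ltr0n// -lee_fin -fine_upperE//.
apply: ge_ereal_sup => _ [P PPP <-].
rewrite -[P _]fineK ?fin_num_measure// lee_fin ler_pdivlMr ?ltr0n// mulrC.
rewrite -lee_fin EFinM fineK ?fin_num_measure//.
rewrite [X in P X](_ : _ = [set w | (j.+1%:R <= \sum_(i < n) (k (X i w))%:R :> R)%R]).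
  apply: (@markov_sum _ _ _ P (fun i w => (k (X i w))%:R)%R) => // i.
    exact: measurable_natr_comp.
  exact: Ek.
by apply/seteqP; split=> w /=; rewrite -natr_sum ler_nat.
Qed.

Lemma nat_weak_lln (eta e : R) : (0 <= mt)%R -> (0 < eta)%R -> (0 < e)%R ->
  exists n0 : nat, forall n, (n0 <= n)%N -> forall P, PP P ->
    P [set w | (n%:R * (mt + 5 * eta) <= (\sum_(i < n) k (X i w))%N%:R)%R] <= e%:E.
Proof.
move=> mt0 eta0 e0.
have [n0 Hn0] := @tail_small R K mt eta e mt0 eta0 e0.
exists n0.+1 => n n0n P PPP.
have ms m := measurable_natr_sum m measurable_natr_comp.
pose s n w := (\sum_(i < n) k (X i w))%N.
have mS j : measurable [set w | (j < s n w)%N] := measurable_natr_ge j.+1 (ms n).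
have m1 i j : measurable [set w | (j < k (X i w))%N]
  := measurable_natr_ge j.+1 (measurable_natr_comp i).
have y0 : (0 <= n%:R * (mt + 4 * eta))%R by rewrite mulr_ge0// addr_ge0// mulr_ge0// ltW.
(* The fifth [eta] is slack for rounding: [t%:R <= n%:R * (mt + 4 * eta)] is strictly below the
   threshold of the event, which therefore forces [t < s n w]. *)
pose t := Num.truncn (n%:R * (mt + 4 * eta)).
have n_gt0 : (0 < n%:R :> R)%R by rewrite ltr0n (leq_trans _ n0n).
have Ht : (fine_upper [set w | (t < s n w)%N] <= e)%R.
  apply: (Hn0 n (fun j => fine_upper [set w | (j < s n w)%N])
      (fun i j => fine_upper [set w | (j < k (X i w))%N])).
  - exact: ltnW.
  - by move=> j; exact: fine_upper_bounds.
  - move=> i j ij; apply: le_fine_upper => // w /=; exact: leq_ltn_trans.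
  - move=> j nKj; rewrite -fine_upper0; congr fine_upper; rewrite -subset0 => w /=.
    by rewrite ltnNge (leq_trans (sum_nat_le_mul n w)).
  - by move=> i j; exact: fine_upper_bounds.
  - exact: tail_gf_sum_indep.
  - exact: markov_sum_upper.
  - exact/ltW/truncnS_gt.
apply: (@le_trans _ _ (P [set w | (t < s n w)%N])); last first.
  rewrite -lee_fin in Ht; apply: le_trans Ht; rewrite -fine_upperE//.
  by apply: ereal_sup_ubound; exists P.
apply: le_measure; rewrite ?inE//.
  exact: measurable_superlevel (ms n).
move=> w /= h; rewrite -(ltr_nat R); apply: lt_le_trans h.
have : (t%:R <= n%:R * (mt + 4 * eta))%R by rewrite truncn_le.
have := mulr_gt0 n_gt0 eta0; lra.
Qed.

End UpperProbability.

(** * Truncation and quantization of real values *)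

Section Truncation.
Context {R : realType}.
Variables (h c alpha : R) (K : nat).
Local Open Scope ring_scope.

(** Grid index of [x] clipped to [[-c, c]] when [K%:R * h = 2 * c]: [minn K] clips above, and
    [Num.truncn], zero on negative numbers, clips below. *)
Definition quantize (x : R) : nat := minn K (Num.truncn ((x + c) / h)).

Lemma quantize_le x : (quantize x <= K)%N. Proof. exact: geq_minl. Qed.

Lemma measurable_quantize : 0 < h ->
  measurable_fun setT (fun x => (quantize x)%:R : R).
Proof.
move=> h0; apply: nondecreasing_measurable => // x y xy.
rewrite ler_nat /quantize leq_min geq_minl/=.
apply: leq_trans (geq_minr _ _) _; apply: le_truncn.
by rewrite ler_pM2r ?invr_gt0// lerD2r.
Qed.

(** This is [|x| * (|x| / c) ^ alpha]: it dominates [|x|] outside [[-c, c]], while a moment bound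
    [C] makes its mean at most [C / c ^ alpha]. *)
Definition tail_weight (x : R) : R := `|x| `^ (1 + alpha) / c `^ alpha.

Lemma tail_weight_ge0 x : 0 <= tail_weight x.
Proof. by rewrite divr_ge0 ?powR_ge0. Qed.

Lemma measurable_tail_weight : measurable_fun setT tail_weight.
Proof.
by apply: measurable_funM => //; exact: measurable_norm_powR.
Qed.

Lemma tail_weight_ge x : 0 < c -> 0 < alpha -> c <= `|x| ->
  `|x| <= tail_weight x.
Proof.
move=> c0 alpha0 cx; have x0 : 0 < `|x| by rewrite (lt_le_trans c0).
rewrite ler_pdivlMr ?powR_gt0// powRD; last by apply/implyP => _; rewrite gt_eqF.
by rewrite powRr1 ?normr_ge0// ler_pM2l// ge0_ler_powR ?nnegrE ?normr_ge0 ?(ltW c0) ?(ltW alpha0).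
Qed.

(** Inside the grid the error is at most [h]; beyond either end it is absorbed by the tail weight,
    which dominates [|x|] there. *)
Lemma quantize_bounds x : 0 < h -> 0 < c -> 0 < alpha -> K%:R * h = 2 * c ->
  h * (quantize x)%:R <= x + c + tail_weight x /\
  x + c <= h * (quantize x)%:R + h + tail_weight x.
Proof.
move=> h0 c0 alpha0 Khc; have W0 := tail_weight_ge0 x.
have Wx := @tail_weight_ge x c0 alpha0.
rewrite /quantize; set t := Num.truncn _.
have [xc|cx] := ltP (x + c) 0.
  have -> : t = 0%N.
    apply/eqP; rewrite -leqn0 leqNgt /t truncn_gt_nat -ltNge.
    by rewrite (@lt_trans _ _ 0)// pmulr_llt0// invr_gt0.
  rewrite minn0.
  have x0 : x < 0 by lra.
  rewrite ltr0_norm// in Wx.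
  have {}Wx : - x <= tail_weight x by apply: Wx; lra.
  by split; lra.
have /andP[t1 t2] : t%:R <= (x + c) / h < t.+1%:R.
  by rewrite truncn_itv// divr_ge0// ltW.
rewrite ler_pdivlMr// in t1; rewrite ltr_pdivrMr// -natr1 in t2.
have [tK|Kt] := leqP t K; first by split; lra.
have Kt' : (K%:R + 1) * h <= t%:R * h by rewrite ler_pM2r// natr1 ler_nat.
have : x <= tail_weight x.
  by rewrite (le_trans (ler_norm x))// tail_weight_ge// (le_trans _ (ler_norm x))//; lra.
by split; lra.
Qed.

End Truncation.

Lemma truncation_parameters (R : realType) (C alpha r h0 : R) :
    (0 < alpha)%R -> (0 < r)%R -> (0 < h0)%R ->
  exists h c : R, exists K : nat, [/\ (0 < h)%R, (h <= h0)%R, (0 < c)%R,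
    (K%:R * h = 2 * c)%R & (C / c `^ alpha <= r)%R].
Proof.
move=> alpha0 r0 h00.
(* [C'] is positive whatever the sign of [C], and [c] solves [C' / c ^ alpha = r]; [K] then refines
   the grid until [h <= h0]. *)
pose C' := (`|C| + 1)%R; have C'0 : (0 < C')%R by rewrite ltr_wpDl.
pose c := ((C' / r) `^ alpha^-1)%R.
have c0 : (0 < c)%R by rewrite powR_gt0// divr_gt0.
pose K := (Num.truncn (2 * c / h0)).+1.
have K0 : (0 < K%:R :> R)%R by rewrite ltr0n.
exists (2 * c / K%:R)%R, c, K; split => //.
- by rewrite divr_gt0// mulr_gt0.
- by rewrite ler_pdivrMr// [leRHS]mulrC -ler_pdivrMr//; exact/ltW/truncnS_gt.
- by rewrite mulrC divfK// gt_eqF.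
- rewrite -powRrM mulVf ?gt_eqF// powRr1; last exact/ltW/divr_gt0.
  rewrite invf_div mulrCA ger_pMr// ler_pdivrMr// mul1r.
  by rewrite (le_trans (ler_norm C))// lerDl.
Qed.

(** * Upper deviations, uniformly over the family of measures *)

Section OneSided.
Context {d : measure_display} {T : measurableType d} {R : realType}.
Variable PP : set (probability T R).
Hypothesis PP0 : PP !=set0.
Variables (X : nat -> {mfun T >-> R}) (g : R -> R) (mu alpha C : R).
Hypothesis indep : exp_independent_seq (upper_probability PP) X.
Hypothesis mg : measurable_fun setT g.
Hypothesis alpha0 : (0 < alpha)%R.
Hypothesis intg : forall i P, PP P ->
  P.-integrable setT (fun w => (g (X i w))%:E).
Hypothesis Eg : forall i P, PP P -> \int[P]_w (g (X i w))%:E <= mu%:E.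
Hypothesis Mg : forall i P, PP P ->
  \int[P]_w (`|g (X i w)| `^ (1 + alpha))%:E <= C%:E.

Lemma measurable_comp_mfun i : measurable_fun setT (g \o X i).
Proof. by apply: (measurableT_comp mg); exact: measurable_funPT. Qed.

(** Stated for [g (X i)] so that the identity and the negation are both covered: independence is
    only assumed of [X], as [g] is absorbed into the test functions. *)
Lemma upper_tail_small (eps e : R) : (0 < eps)%R -> (0 < e)%R ->
  exists n0 : nat, forall n, (n0 <= n)%N -> forall P, PP P ->
    P [set w | (n%:R * (mu + eps) <= \sum_(i < n) g (X i w))%R] <= e%:E.
Proof.
move=> eps0 e0.
(* The bound [eps / 8] on [h] and on the tail mean gives [r0 + h <= eps / 4]; the bound
   [eps * e / 4] makes Markov's inequality at level [eps / 2] yield [e / 2]. *)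
have [||h [c [K [h0 heps c0 Khc Cc]]]] :=
    @truncation_parameters R C alpha (Num.min (eps / 8) (eps * e / 4))%R (eps / 8) alpha0.
- by rewrite lt_min !divr_gt0// mulr_gt0.
- by rewrite divr_gt0.
pose r0 := (C / c `^ alpha)%R.
have r8 : (r0 <= eps / 8)%R by rewrite (le_trans Cc)// ge_min lexx.
have re : (r0 <= eps * e / 4)%R by rewrite (le_trans Cc)// ge_min lexx orbT.
pose W := tail_weight c alpha.
pose k := quantize h c K.
have mW i : measurable_fun setT (fun w => W (g (X i w))).
  by apply: (measurableT_comp (measurable_tail_weight c alpha)); exact: measurable_comp_mfun.
have mk : measurable_fun setT (fun x => (k (g x))%:R : R).
  by apply: (measurableT_comp (measurable_quantize c K h0)).
have mkX i : measurable_fun setT (fun w => (k (g (X i w)))%:R : R).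
  by apply: (measurableT_comp mk); exact: measurable_funPT.
have kK x : (k (g x) <= K)%N by exact: quantize_le.
have ca0 : (0 < c `^ alpha)%R by rewrite powR_gt0.
have EW i P : PP P -> \int[P]_w (W (g (X i w)))%:E <= r0%:E.
  move=> PPP; rewrite /W /tail_weight.
  under eq_integral do rewrite mulrC EFinM.
  rewrite ge0_integralZl//.
  - rewrite /r0 mulrC EFinM lee_pmul2l// ?lte_fin ?invr_gt0//; exact: Mg.
  - by apply/measurable_EFinP/measurable_norm_powR; exact: measurable_comp_mfun.
  - by rewrite lee_fin invr_ge0 ltW.
have intW i P : PP P -> P.-integrable setT (fun w => (W (g (X i w)))%:E).
  move=> PPP; apply/integrableP; split; first exact/measurable_EFinP.
  under eq_integral do rewrite gee0_abs ?lee_fin ?tail_weight_ge0//.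
  by rewrite (le_lt_trans (EW _ _ PPP))// ltry.
pose mt := (h^-1 * (mu + c + r0))%R.
have Ek i P : PP P -> \int[P]_w ((k (g (X i w)))%:R)%:E <= mt%:E.
  move=> PPP.
  have icst : P.-integrable setT (fun=> c%:E : \bar R).
    exact: finite_measure_integrable_cst.
  have icW : P.-integrable setT (fun w => c%:E + (W (g (X i w)))%:E).
    by apply: integrableD => //; exact: intW.
  have igcW : P.-integrable setT (fun w => (g (X i w))%:E + (c%:E + (W (g (X i w)))%:E)).
    by apply: integrableD => //; exact: intg.
  apply: (@le_trans _ _ (\int[P]_w (h^-1%:E *
      ((g (X i w))%:E + (c%:E + (W (g (X i w)))%:E))))).
    apply: ge0_le_integral => //.
    - exact/measurable_EFinP.
    - by apply: measurable_funeM; case/integrableP: igcW.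
    - move=> w _; rewrite -!EFinD -EFinM lee_fin mulrC ler_pdivlMr// mulrC addrA.
      by have [] := quantize_bounds (g (X i w)) h0 c0 alpha0 Khc.
  rewrite integralZl//= integralD//=; [|exact: intg].
  rewrite integralD//=; [|exact: intW].
  rewrite integral_cst// [X in c%:E * X](@probability_setT _ _ _ P) mule1 /mt EFinM lee_pmul2l// ?lte_fin ?invr_gt0//.
  rewrite -[(mu + c + r0)%R]addrA (EFinD mu) (EFinD c); apply: leeD; first exact: Eg.
  by apply: leeD => //; exact: EW.
have mt0 : (0 <= mt)%R.
  have [P PPP] := PP0; rewrite -lee_fin; apply: le_trans (Ek 0%N P PPP).
  by apply: integral_ge0 => w _; rewrite lee_fin.
(* Chosen so that [h * (5 * eta) = eps / 4]. *)
pose eta := (eps / (20 * h))%R.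
have eta0 : (0 < eta)%R by rewrite divr_gt0// mulr_gt0.
have [//|n0 Hn0] := @nat_weak_lln _ _ _ PP PP0 X (k \o g) K indep mk kK mt Ek eta (e / 2) mt0 eta0.
  by rewrite divr_gt0.
exists n0.+1 => n n0n P PPP.
have n_gt0 : (0 < n%:R :> R)%R by rewrite ltr0n (leq_trans _ n0n).
set A := [set w | _].
pose B1 := [set w | (n%:R * (mt + 5 * eta) <= (\sum_(i < n) k (g (X i w)))%N%:R)%R].
pose B2 := [set w | (n%:R * (eps / 2) <= \sum_(i < n) W (g (X i w)))%R].
have mA : measurable A by apply: measurable_superlevel; apply: measurable_sum => i; exact: measurable_comp_mfun.
have mB1 : measurable B1 by apply: measurable_superlevel; exact: (measurable_natr_sum n mkX).
have mB2 : measurable B2 by apply: measurable_superlevel; apply: measurable_sum => i; exact: mW.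
(* Off [B2] the tail weights cost less than [n%:R * (eps / 2)]; rescaling by [h], the remaining
   [eps / 2] covers [r0 + h] and the deviation [eps / 4] defining [B1]. *)
have AB : A `<=` B1 `|` B2.
  move=> w; rewrite /A/= => Aw.
  have [Bw|Bw] := leP (n%:R * (eps / 2))%R (\sum_(i < n) W (g (X i w)))%R; first by right.
  left; rewrite /B1/=.
  have : (\sum_(i < n) (g (X i w) + c) <=
      \sum_(i < n) (h * (k (g (X i w)))%:R + h + W (g (X i w))))%R.
    apply: ler_sum => i _.
    by have [_] := quantize_bounds (g (X i w)) h0 c0 alpha0 Khc.
  rewrite !big_split/= !sumr_const card_ord -mulr_sumr -natr_sum.
  rewrite -[(c *+ n)%R]mulr_natl -[(h *+ n)%R]mulr_natl.
  set Sk := (\sum_(i < n) k _)%N => H.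
  rewrite -(ler_pM2l h0) mulrCA.
  have -> : (h * (mt + 5 * eta) = mu + c + r0 + eps / 4)%R.
    have hmt : (h * mt = mu + c + r0)%R by rewrite /mt mulVKf// gt_eqF.
    have heta : (h * (5 * eta) = eps / 4)%R by rewrite /eta; field; rewrite gt_eqF.
    by rewrite mulrDr hmt heta.
  have : (n%:R * (r0 + h) <= n%:R * (eps / 4))%R by rewrite ler_pM2l//; lra.
  lra.
have P2 : P B2 <= (e / 2)%:E.
  have a0 : (0 < n%:R * (eps / 2))%R by rewrite mulr_gt0// divr_gt0.
  have := @markov_sum _ _ _ P (fun i w => W (g (X i w))) n r0 (n%:R * (eps / 2))%R mW
    (fun i w => tail_weight_ge0 c alpha _) (fun i => EW i P PPP) (ltW a0).
  rewrite -/B2 -[P B2]fineK ?fin_num_measure// -EFinM !lee_fin.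
  rewrite -mulrA ler_pM2l// => H.
  rewrite -(ler_pM2l (_ : 0 < eps / 2)%R); first by lra.
  by rewrite divr_gt0.
apply: (@le_trans _ _ (P (B1 `|` B2))).
  by apply: le_measure; rewrite ?inE//; exact: measurableU.
apply: (@le_trans _ _ (P B1 + P B2)); first exact: measureU2.
rewrite [e in leRHS]splitr EFinD; apply: leeD => //.
by apply: Hn0 => //; exact: ltnW.
Qed.

End OneSided.

(** * From the moment bound to the two-sided law *)

(** Pointwise [|Y| <= 1 + |Y| ^ (1 + alpha)]; for [|Y| >= 1] this is the tail weight bound at
    [c = 1]. *)
Lemma integrable_of_moment (d : measure_display) (T : measurableType d)
    (R : realType) (P : probability T R) (Y : {mfun T >-> R}) (alpha : R) :
    (0 < alpha)%R -> \int[P]_w (`|Y w| `^ (1 + alpha))%:E < +oo ->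
  P.-integrable setT (EFin \o Y).
Proof.
move=> alpha0 MY.
have mM : measurable_fun setT (fun w => `|Y w| `^ (1 + alpha))%R.
  exact: measurable_norm_powR.
apply: (@le_integrable _ _ _ _ _ _ _
  (fun w => 1%:E + (`|Y w| `^ (1 + alpha))%:E)) => //.
- exact/measurable_EFinP.
- move=> w _; rewrite -EFinD abse_EFin lee_fin.
  rewrite [leRHS]ger0_norm ?addr_ge0 ?powR_ge0//.
  have [Y1|/ltW Y1] := leP `|Y w|%R 1%R.
    by rewrite (le_trans Y1)// lerDl powR_ge0.
  have := @tail_weight_ge R 1 alpha (Y w) ltr01 alpha0 Y1.
  by rewrite /tail_weight powR1 divr1 => /le_trans -> //; rewrite lerDr.
- apply: integrableD => //; first exact: finite_measure_integrable_cst.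
  apply/integrableP; split; first exact/measurable_EFinP.
  by under eq_integral do rewrite gee0_abs ?lee_fin ?powR_ge0//.
Qed.

Theorem theorem5p1 (d : measure_display) (T : measurableType d)
    (R : realType) (PP : set (probability T R)) (X : nat -> {mfun T >-> R})
    (mu_up mu_lo alpha : R) :
  PP !=set0 ->
  exp_independent_seq (upper_probability PP) X ->
  (forall k, upper_expectation PP (X k) = mu_up%:E) ->
  (forall k, lower_expectation PP (X k) = mu_lo%:E) ->
  (0 < alpha)%R -> (alpha < 1)%R ->
  ereal_sup [set upper_expectation PP
                   (fun w => (`|X k w| `^ (1 + alpha))%R) | k in setT] < +oo ->
  forall eps : R, (0 < eps)%R ->
    (fun n : nat => lower_probability PP
       [set w | (mu_lo - eps <= n%:R^-1 * \sum_(k < n) X k w <= mu_up + eps)%R])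
      @ \oo --> 1.
Proof.
move=> PP0 indep Eup Elo alpha0 _ Msup eps eps0.
have [P0 PPP0] := PP0.
set M := ereal_sup _ in Msup.
have MX i P : PP P -> \int[P]_w (`|X i w| `^ (1 + alpha))%:E <= M.
  move=> PPP; apply: (@le_trans _ _ (upper_expectation PP
    (fun w => (`|X i w| `^ (1 + alpha))%R))).
    by apply: ereal_sup_ubound; exists P => //; rewrite unlock.
  by apply: ereal_sup_ubound; exists i.
have M0 : 0 <= M.
  apply: le_trans (MX 0%N P0 PPP0).
  by apply: integral_ge0 => w _; rewrite lee_fin powR_ge0.
have [C MC] : exists C : R, M = C%:E.
  by exists (fine M); rewrite fineK// fin_numElt (lt_le_trans _ M0).
have intX i P : PP P -> P.-integrable setT (EFin \o X i).
  by move=> PPP; apply: (integrable_of_moment alpha0); rewrite (le_lt_trans (MX i P PPP)).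
have upX i P : PP P -> \int[P]_w (X i w)%:E <= mu_up%:E.
  by move=> PPP; rewrite -(Eup i); apply: ereal_sup_ubound; exists P => //; rewrite unlock.
have loX i P : PP P -> mu_lo%:E <= \int[P]_w (X i w)%:E.
  by move=> PPP; rewrite -(Elo i); apply: ereal_inf_lbound; exists P => //; rewrite unlock.
pose A n : set T :=
  [set w | (mu_lo - eps <= n%:R^-1 * \sum_(k < n) X k w <= mu_up + eps)%R].
have mSX n : measurable_fun setT (fun w => \sum_(k < n) X k w)%R.
  by apply: measurable_sum => i; exact: measurable_funPT.
have mA n : measurable (A n).
  rewrite /A [X in measurable X](_ : _ = setT `&`
      (fun w => n%:R^-1 * \sum_(k < n) X k w)%R @^-1` `[(mu_lo - eps)%R, (mu_up + eps)%R]%classic).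
    have : measurable_fun setT (fun w => n%:R^-1 * \sum_(k < n) X k w)%R.
      exact: measurable_funM.
    by apply => //; exact: measurable_itv.
  by rewrite setTI; apply/seteqP; split=> w /=; rewrite in_itv.
have nu_le1 n : lower_probability PP (A n) <= 1.
  apply: le_trans (probability_le1 P0 (mA n)).
  by apply: ereal_inf_lbound; exists P0.
have nu_near (e : R) : (0 < e)%R ->
    \forall n \near \oo, (1 - e)%:E <= lower_probability PP (A n).
  move=> e0; have e20 : (0 < e / 2)%R by rewrite divr_gt0.
  have eps20 : (0 < eps / 2)%R by rewrite divr_gt0.
  have [n1 Hup] := @upper_tail_small _ _ _ PP PP0 X id mu_up alpha C indep
    (@measurable_id _ _ _) alpha0 intX upX
    (fun i P PPP => eq_ind M (fun c => _ <= c) (MX i P PPP) _ MC) (eps / 2) (e / 2) eps20 e20.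
  (* Lower deviations of [X] are upper deviations for [g = -%R], whose means are at most
     [- mu_lo]. *)
  have [n2 Hlo] : exists n0 : nat, forall n, (n0 <= n)%N -> forall P, PP P ->
    P [set w | (n%:R * (- mu_lo + eps / 2) <= \sum_(i < n) - X i w)%R] <= (e / 2)%:E.
    apply: (@upper_tail_small _ _ _ PP PP0 X -%R (- mu_lo) alpha C indep) => //.
    - by move=> i P PPP; exact: (integrableN (intX i P PPP)).
    - move=> i P PPP; under eq_integral do rewrite EFinN.
      by rewrite integralN ?integrable_add_def//; [rewrite EFinN leeN2 loX | exact: intX].
    - by move=> i P PPP; under eq_integral do rewrite normrN; rewrite -MC; exact: MX.
  exists (maxn n1 n2).+1 => // n /= nn.
  have n_gt0 : (0 < n%:R :> R)%R by rewrite ltr0n (leq_trans _ nn).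
  have n1n : (n1 <= n)%N by rewrite (leq_trans (leq_maxl n1 n2))// ltnW.
  have n2n : (n2 <= n)%N by rewrite (leq_trans (leq_maxr n1 n2))// ltnW.
  apply: le_ereal_inf_tmp => _ [P PPP <-].
  set B1 := [set w | (n%:R * (mu_up + eps / 2) <= \sum_(i < n) X i w)%R].
  set B2 := [set w | (n%:R * (- mu_lo + eps / 2) <= \sum_(i < n) - X i w)%R].
  have P1 : P B1 <= (e / 2)%:E by exact: Hup.
  have P2 : P B2 <= (e / 2)%:E by exact: Hlo.
  have mB1 : measurable B1 by exact: measurable_superlevel.
  have mB2 : measurable B2.
    by apply: measurable_superlevel; apply: measurable_sum => i; exact: measurableT_comp.
  have AB : ~` A n `<=` B1 `|` B2.
    move=> w /= /negP; rewrite negb_and -!ltNge => /orP[h|h].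
      right; rewrite /B2/= sumrN.
      move: h; rewrite mulrC ltr_pdivrMr// => h; nra.
    by left; rewrite /B1/=; move: h; rewrite mulrC ltr_pdivlMr// => h; nra.
  have : P (~` A n) <= e%:E.
    apply: (@le_trans _ _ (P (B1 `|` B2))).
      apply: le_measure; rewrite ?inE//; last exact: measurableU.
      exact: measurableC.
    apply: (@le_trans _ _ (P B1 + P B2)); first exact: measureU2.
    by rewrite [e in leRHS]splitr EFinD; apply: leeD.
  rewrite probability_setC// -[P (A n)]fineK ?fin_num_measure//.
  by rewrite -EFinB !lee_fin lerBlDr addrC -lerBlDr.
apply/fine_cvgP; split.
  near=> n; rewrite fin_numElt (le_lt_trans (nu_le1 n) (ltry _)) andbT.
  (* [nu_near] at [e = 1] keeps the values away from [-oo]. *)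
  apply: (@lt_le_trans _ _ (1 - 1)%:E); first exact: ltNyr.
  by near: n; exact: nu_near.
apply/cvgrPdist_le => /= e e0; near=> n.
have h1 := nu_le1 n.
have h2 : (1 - e)%:E <= lower_probability PP (A n) by near: n; exact: nu_near.
move: h1 h2; rewrite /comp -/(A n); case: (lower_probability PP (A n)) => [r| |]//.
rewrite !lee_fin/= => h1 h2; rewrite ger0_norm; lra.
Unshelve. all: by end_near.
Qed.
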